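(* Let $\mathbf{w}\in\mathbb{R}_{>0}^d$, let $I\subseteq\{1,\dots,d\}$ be nonempty, $k:=|I|$, $J:=\{1,\dots,d\}\setminus I$, $a:=\sqrt{\sum_{i\in I}w_i^2}$, and $\mathbf{e}_0':=-\frac1a\sum_{i\in I}w_i\mathbf{e}_i$. Let $\mathbf{q}_1,\dots,\mathbf{q}_{k-1}$ be an orthonormal basis of the subspace $L=\{\mathbf{x}\in\mathbb{R}^d:\sum_{i}w_ix_i=0,\ x_j=0\ \text{for all } j\in J\}$, so that $\mathbf{q}_1,\dots,\mathbf{q}_{k-1},\mathbf{e}_0'$ and the $\mathbf{e}_j$ ($j\in J$) form an orthonormal basis of $\mathbb{R}^d$. For $$\mathbf{z}=z_0\mathbf{e}_0'+\sum_{j\in J}z_j\mathbf{e}_j+\sum_{j=1}^{k-1}g_j\mathbf{q}_j\in\mathbb{R}^d,$$ let $j_1,\dots,j_{d-k}$ be a permutation of $J$ such that $|z_{j_1}|/w_{j_1}\geq\dots\geq|z_{j_{d-k}}|/w_{j_{d-k}}$. Define $$b_l:=\begin{cases}\sum_{i=1}^l w_{j_i}|z_{j_i}|-\dfrac{a^2+\sum_{i=1}^l w_{j_i}^2}{w_{j_{l+1}}}\,|z_{j_{l+1}}| & \text{if } 0\leq l\leq d-k-1,\\[2mm] \sum_{i=1}^{d-k}w_{j_i}|z_{j_i}| & \text{if } l=d-k,\end{cases}$$ and let $m$ be the unique integer such that $b_{m-1}<az_0\leq b_m$ (with the convention that $b_{-1}=-\infty$ and $b_{d-k+1}=\infty$).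 If $$t:=\frac{-az_0+\sum_{i=1}^m w_{j_i}|z_{j_i}|}{a^2+\sum_{i=1}^m w_{j_i}^2},\qquad \alpha_i:=w_{j_i}|z_{j_i}|-w_{j_i}^2t,\qquad \mathbf{u}_i:=\frac{\mathbf{e}_0'}{a}+\frac{\operatorname{sign}(z_{j_i})}{w_{j_i}}\mathbf{e}_{j_i}$$ for $i=1,\dots,m$, then the following statements hold: (1) The projection $\pi_C(\mathbf{z})$ of $\mathbf{z}$ onto $C:=D(I,\mathbf{w})$ is in the relative interior of a face of $C$ of dimension $m+k-1$, and is given by the formula $$\pi_C(\mathbf{z})=\sum_{i=1}^m\alpha_i\mathbf{u}_i+\sum_{j=1}^{k-1}g_j\mathbf{q}_j.$$ (2) The following equality holds: $$\|\pi_C(\mathbf{z})\|^2=(z_0+at)^2+\sum_{i=1}^m(|z_{j_i}|-w_{j_i}t)^2+\sum_{j=1}^{k-1}g_j^2.$$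
   Context: $\mathbf{e}_1,\dots,\mathbf{e}_d$ is the canonical basis of $\mathbb{R}^d$, $\|\cdot\|$ is the Euclidean norm, and $\pi_C$ denotes the Euclidean projection onto the closed convex cone $C$. Weighted norm: $\|\mathbf{x}\|_1^{\mathbf{w}}=\sum_{i=1}^d w_i|x_i|$. Descent cone: for convex $f:\mathbb{R}^d\to\mathbb{R}$, $D(f,\mathbf{y})=\operatorname{cone}\{\mathbf{x}-\mathbf{y}: f(\mathbf{x})\le f(\mathbf{y})\}$. For $I\subseteq\{1,\dots,d\}$ write $D(I,\mathbf{w}):=D(\|\cdot\|_1^{\mathbf{w}},\mathbf{y})$, where $\mathbf{y}$ is a vector with nonnegative entries and support $\{i:y_i\neq0\}=I$; one may take $\mathbf{y}=\frac1k\sum_{i\in I}\mathbf{e}_i/w_i$ with $k=|I|$.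
   Formalization: When m = d−k+1 (z interior to C) the index j_m does not exist, so t, α_m, u_m are undefined; formulas (1) and (2) are proved for m ≤ d−k, and for m = d−k+1 it is proved instead that π_C(z) = z with the matching norm identity. The face claim holds for all m. *)

(* Defs.v *)
From HB Require Import structures.
From mathcomp Require Export all_boot all_order all_algebra.
From mathcomp Require Export all_classical all_reals topology normedtype.

Set Implicit Arguments.
Unset Strict Implicit.
Unset Printing Implicit Defensive.

Import Order.TTheory GRing.Theory Num.Theory.
Import numFieldTopology.Exports numFieldNormedType.Exports.

Local Open Scope ring_scope.
Local Open Scope classical_set_scope.

Section Euclidean.
Context {R : realType} {d : nat}.
Implicit Types (x y p : 'rV[R]_d) (S C F : set 'rV[R]_d).

Definition dotv x y : R := \sum_(i < d) x 0 i * y 0 i.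

(* The norm [`|x|] of the library on row vectors is the sup norm. *)
Definition enorm x : R := Num.sqrt (dotv x x).

Definition orthonormal_basis (s : seq 'rV[R]_d) (L : set 'rV[R]_d) : Prop :=
  (forall i j, (i < size s)%N -> (j < size s)%N ->
     dotv s`_i s`_j = (i == j)%:R) /\
  (forall x, L x <-> x \in <<s>>%VS).

Definition is_proj C x p : Prop :=
  C p /\ forall c, C c -> enorm (x - p) <= enorm (x - c).

(* Junk value 0 when x has no nearest point in C. *)
Definition proj C x : 'rV[R]_d := xget 0 [set p | is_proj C x p].

Definition cone S : set 'rV[R]_d :=
  [set x | exists (n : nat) (c : 'I_n -> R) (s : 'I_n -> 'rV[R]_d),
     (forall i, 0 <= c i /\ S (s i)) /\ x = \sum_(i < n) c i *: s i].

Definition affine_hull S : set 'rV[R]_d :=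
  [set x | exists (n : nat) (c : 'I_n -> R) (s : 'I_n -> 'rV[R]_d),
     [/\ forall i, S (s i), \sum_(i < n) c i = 1
       & x = \sum_(i < n) c i *: s i]].

(* The dimension of a nonempty convex set is that of its affine hull,
   a translate p + U of a linear subspace U. *)
Definition has_dim S (n : nat) : Prop :=
  exists (p : 'rV[R]_d) (U : {vspace 'rV[R]_d}),
    (forall x, affine_hull S x <-> x - p \in U) /\ \dim U = n.

(* The topology of row vectors is the product topology, which is also the one
   defined by the Euclidean norm. *)
Definition relint S : set 'rV[R]_d :=
  [set x | S x /\ within (affine_hull S) (nbhs x) S].

(* Faces of a polyhedral cone: the cone itself and its intersections with its
   supporting hyperplanes. *)
Definition is_face C F : Prop :=
  F = C \/
  exists v : 'rV[R]_d,
    [/\ v != 0, forall x, C x -> dotv v x <= 0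
      & F = C `&` [set x | dotv v x = 0]].

Definition descent_cone (f : 'rV[R]_d -> R) y : set 'rV[R]_d :=
  cone [set x - y | x in [set x | f x <= f y]].

Definition wnorm1 (w x : 'rV[R]_d) : R := \sum_(i < d) w 0 i * `|x 0 i|.

End Euclidean.

(* Main.v *)
From HB Require Import structures.
Require Import Defs.
From mathcomp Require Import ring lra.

(** Only two features of the descent cone [C] matter. It is the set where the
    directional derivative of the weighted norm at [y], called [wdir] below, is
    nonpositive ([descent_coneE]): in the coordinates along [e0'], the [e i]
    outside [I] and the [q i], this reads [sum_J w_j |x_j| <= a x_0]. And [wdir]
    is piecewise linear, with linear part [w] on [I] and absolute values weighted
    by [w] outside.

    Projection. The Karush-Kuhn-Tucker conditions at a boundary point [p] ask
    that [z - p] be [t] times a subgradient of [wdir] at [p], with [0 <= t]. On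
    [I] this means subtracting [t w], that is adding [a t] to the coordinate
    along [e0']; outside [I] it means soft-thresholding the coordinates of [z] at
    the level [t w] ([proj_soft_threshold]). The surviving coordinates are those
    with [t < |z_j| / w_j], hence the first [m] in the order given by the
    permutation. Requiring [wdir p = 0] then determines [t] as a function of [m],
    and the inequalities [b_(m-1) < a z_0 <= b_m] say exactly that this [t]
    separates the [m]-th ratio from the next one ([rank_active]). As [b] is
    nondecreasing ([threshold_homo]), one and only one [m] qualifies
    ([exists_unique_rank]). The rank after the last one is reached exactly when
    [wdir z < 0], in which case [z] is interior to [C].

    Face. The linear functional that agrees with [wdir] near [p] in the
    directions where [wdir] is differentiable is at most [wdir] everywhere, so it
    exposes a face of [C] ([boundary_face]). Vectors of this face vanish wherever
    [p] does outside [I], and their other coordinates outside [I] have weakly the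
    signs of those of [p]. Near [p] these sign constraints are automatic, so the
    face spans the hyperplane cut by the functional in a coordinate subspace of
    dimension [m + k] ([dim_span_delta_ker]), and [p] is in its relative interior
    ([has_dim_relint]).

    The two explicit formulas are then read off in the orthonormal frame
    ([enorm_frame]). *)

Set Implicit Arguments.
Unset Strict Implicit.
Unset Printing Implicit Defensive.

Import Order.TTheory GRing.Theory Num.Theory.
Import numFieldTopology.Exports numFieldNormedType.Exports.

Local Open Scope ring_scope.
Local Open Scope classical_set_scope.

(** * Euclidean geometry of row vectors *)

Section Dotv.
Context {R : realType} {d : nat}.
Implicit Types (x y p u v c : 'rV[R]_d) (C F : set 'rV[R]_d).

Lemma dotvC x y : dotv x y = dotv y x.
Proof. by apply: eq_bigr => i _; rewrite mulrC. Qed.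

Lemma dotv_is_linear v : linear (dotv v : 'rV[R]_d -> R^o).
Proof.
move=> k x y; rewrite /dotv scaler_sumr -big_split /=.
by apply: eq_bigr => i _; rewrite !mxE mulrDr mulrCA.
Qed.

HB.instance Definition _ v :=
  GRing.isLinear.Build R 'rV[R]_d R^o _ (dotv v : 'rV[R]_d -> R^o)
    (dotv_is_linear v).

Lemma dotv0r v : dotv v 0 = 0.
Proof. exact: (linear0 (dotv v : 'rV[R]_d -> R^o)). Qed.

Lemma dotvZr v k x : dotv v (k *: x) = k * dotv v x.
Proof. exact: (linearZ_LR (dotv v : 'rV[R]_d -> R^o)). Qed.

Lemma dotv_sumr v (T : Type) (s : seq T) (P : pred T) (f : T -> 'rV[R]_d) :
  dotv v (\sum_(i <- s | P i) f i) = \sum_(i <- s | P i) dotv v (f i).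
Proof. exact: (linear_sum (dotv v : 'rV[R]_d -> R^o)). Qed.

Lemma dotv_delta v i : dotv v (delta_mx 0 i) = v 0 i.
Proof.
rewrite /dotv (bigD1 i) //= big1 ?mxE ?eqxx ?mulr1 ?addr0 // => l /negPf li.
by rewrite mxE li andbF mulr0.
Qed.

Lemma dotv_ge0 x : 0 <= dotv x x.
Proof. by apply: sumr_ge0 => i _; rewrite -expr2 sqr_ge0. Qed.

Lemma dotv_eq0 x : dotv x x = 0 -> x = 0.
Proof.
move=> /eqP; rewrite psumr_eq0 => [/allP x0|i _]; last by rewrite -expr2 sqr_ge0.
apply/rowP => i; rewrite mxE; apply/eqP; rewrite -sqrf_eq0 expr2.
exact: (x0 i (mem_index_enum i)).
Qed.

Lemma enormE x : enorm x ^+ 2 = dotv x x.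
Proof. by rewrite sqr_sqrtr // dotv_ge0. Qed.

Lemma ler_enorm x y : (enorm x <= enorm y) = (dotv x x <= dotv y y).
Proof. by rewrite ler_sqrt // dotv_ge0. Qed.

(** A point of [C] whose displacement from [x] makes no acute angle with [C]
    beats every other point by the square of the distance between the two; the
    minimiser is thus unique, which makes it the value of [proj]. *)
Lemma proj_obtuse C x p :
    C p -> (forall c, C c -> dotv (x - p) (c - p) <= 0) ->
  is_proj C x p /\ proj C x = p.
Proof.
move=> Cp obt.
have E c : dotv (x - c) (x - c) =
    dotv (x - p) (x - p) + dotv (c - p) (c - p) - 2 * dotv (x - p) (c - p).
  rewrite /dotv mulr_sumr -sumrN -!big_split /=.
  by apply: eq_bigr => i _; rewrite !mxE; ring.
have pp : is_proj C x p.
  split=> // c Cc; rewrite ler_enorm (E c).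
  by have := obt c Cc; have := dotv_ge0 (c - p); lra.
split=> //; apply: (xget_unique _ pp) => c [Cc /(_ p Cp)].
rewrite ler_enorm (E c) => le; apply/subr0_eq/dotv_eq0.
by have := obt c Cc; have := dotv_ge0 (c - p); lra.
Qed.

Lemma orthonormal_free (s : seq 'rV[R]_d) :
  (forall i j, (i < size s)%N -> (j < size s)%N ->
     dotv s`_i s`_j = (i == j)%:R) -> free s.
Proof.
move=> os; apply/(@freeP _ _ _ (in_tuple s)) => k k0 i.
have := congr1 (dotv s`_i) k0; rewrite dotv_sumr (bigD1 i) //= big1.
  by rewrite addr0 dotvZr os // eqxx mulr1 => ->; rewrite dotv0r.
by move=> l /negPf li; rewrite dotvZr os // eq_sym (inj_eq val_inj) li mulr0.
Qed.

Lemma orthonormal_cat (s1 s2 : seq 'rV[R]_d) :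
    (forall i j, (i < size s1)%N -> (j < size s1)%N ->
       dotv s1`_i s1`_j = (i == j)%:R) ->
    (forall i j, (i < size s2)%N -> (j < size s2)%N ->
       dotv s2`_i s2`_j = (i == j)%:R) ->
    {in s1 & s2, forall x y, dotv x y = 0} ->
  forall i j, (i < size (s1 ++ s2))%N -> (j < size (s1 ++ s2))%N ->
    dotv (s1 ++ s2)`_i (s1 ++ s2)`_j = (i == j)%:R.
Proof.
move=> o1 o2 o12 i j; rewrite size_cat !nth_cat => lti ltj.
case: ltnP => hi; case: ltnP => hj.
- exact: o1.
- rewrite o12 ?mem_nth ?ltn_subLR // (_ : (i == j) = false) //.
  by apply: ltn_eqF; apply: leq_trans hj.
- rewrite dotvC o12 ?mem_nth ?ltn_subLR // (_ : (i == j) = false) //.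
  by apply: gtn_eqF; apply: leq_trans hi.
- by rewrite o2 ?ltn_subLR // eqn_sub2rE.
Qed.

Lemma orthonormal_delta (s : seq 'I_d) : uniq s ->
  let e := [seq delta_mx 0 i : 'rV[R]_d | i <- s] in
  forall i j, (i < size e)%N -> (j < size e)%N -> dotv e`_i e`_j = (i == j)%:R.
Proof.
move=> us e i j; rewrite /e size_map => lti ltj.
have x0 : 'I_d by case: s lti {us e ltj} => [|a].
by rewrite !(nth_map x0) // dotv_delta mxE eqxx nth_uniq // eq_sym.
Qed.

Lemma mem_ker_dotv v x :
  (x \in lker (linfun (dotv v : 'rV[R]_d -> R^o))) = (dotv v x == 0).
Proof. by rewrite memv_ker lfunE. Qed.

Lemma sum_deltaE (P : pred 'I_d) (f : 'I_d -> R) i :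
  (\sum_(l | P l) f l *: delta_mx 0 l : 'rV[R]_d) 0 i = if P i then f i else 0.
Proof.
rewrite summxE big_mkcond (bigD1 i) //= big1 => [|l /negPf li].
  by rewrite !mxE !eqxx mulr1 addr0.
by rewrite !mxE [i == l]eq_sym li andbF mulr0 if_same.
Qed.

Lemma row_sum_deltaP (P : pred 'I_d) x : (forall i, ~~ P i -> x 0 i = 0) ->
  x = \sum_(i | P i) x 0 i *: delta_mx 0 i.
Proof.
by move=> x0; apply/rowP => i; rewrite sum_deltaE; case: ifPn => // /x0.
Qed.

Lemma mem_span_delta (B : {set 'I_d}) x :
  reflect (forall i, i \notin B -> x 0 i = 0)
          (x \in <<[seq (delta_mx 0%R i : 'rV[R]_d) | i <- enum B]>>%VS).
Proof.
apply: (iffP idP) => [|x0].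
  move=> xB i iB; apply/eqP; rewrite -dotv_delta dotvC -mem_ker_dotv.
  move: x xB; apply/subvP/span_subvP => _ /mapP [l lB ->].
  rewrite mem_ker_dotv dotv_delta mxE eqxx /=.
  by case: (eqVneq l i) lB => [->|_ _ //]; rewrite mem_enum (negPf iB).
rewrite (row_sum_deltaP x0); apply: memv_suml => i iB.
by apply/memvZ/memv_span/map_f; rewrite mem_enum.
Qed.

(** Among the vectors supported in [B], the condition [v . x = 0] cuts the
    dimension by exactly one, since [v] itself violates it. *)
Lemma dim_span_delta_ker (B : {set 'I_d}) v :
    v != 0 -> (forall i, i \notin B -> v 0 i = 0) ->
  \dim (<<[seq delta_mx 0 i : 'rV[R]_d | i <- enum B]>>
        :&: lker (linfun (dotv v : 'rV[R]_d -> R^o))) = #|B|.-1.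
Proof.
move=> v0 vB; set E := span _; set f := linfun _.
have dE : \dim E = #|B|.
  rewrite (eqnP (orthonormal_free (orthonormal_delta (enum_uniq B)))).
  by rewrite size_map -cardE.
have df : \dim (f @: E) = 1%N.
  apply/eqP; rewrite eqn_leq lt0n dimv_eq0; apply/andP; split.
    by rewrite (leq_trans (dimvS (subvf _))) // dimvf.
  apply: contra v0 => /eqP fE; apply/eqP/dotv_eq0.
  have : f v \in (f @: E)%VS by apply/memv_img/mem_span_delta.
  by rewrite fE memv0 lfunE => /eqP.
by have := limg_ker_dim f E; rewrite df dE => <-; rewrite addn1.
Qed.

Lemma affine_hull_min C (U : {vspace 'rV[R]_d}) x :
  (forall c, C c -> c \in U) -> affine_hull C x -> x \in U.
Proof.
by move=> CU [n [c [s [Cs _ ->]]]]; apply: memv_suml => i _; apply/memvZ/CU.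
Qed.

(** A set lying in a subspace and filling it near [p] has that subspace as
    affine hull: any point of the subspace is on a line through [p] and a
    nearby point of the set. *)
Lemma has_dim_relint F (U : {vspace 'rV[R]_d}) p :
    (forall x, F x -> x \in U) -> F p ->
    (\forall x \near p, x \in U -> F x) ->
  has_dim F (\dim U) /\ relint F p.
Proof.
move=> FU Fp nF.
have affE x : affine_hull F x <-> x \in U.
  split=> [|xU]; first exact: affine_hull_min.
  have [e /= e0 He] := (nbhs_normP _ _).1 nF.
  have n0 : 0 < `|x - p| + 1 by rewrite ltr_wpDl.
  pose k := e / (`|x - p| + 1).
  have k0 : 0 < k by rewrite divr_gt0.
  have Fk : F (p + k *: (x - p)).
    apply: He; last by apply/memvD/memvZ/memvB => //; apply: FU.
    rewrite /= opprD addrA subrr add0r normrN normrZ gtr0_norm //.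
    by rewrite /k mulrAC ltr_pdivrMr // ltr_pM2l // ltrDl.
  exists 2%N, (fun i => if i == ord0 then 1 - k^-1 else k^-1),
    (fun i => if i == ord0 then p else p + k *: (x - p)); split.
  - by move=> i; case: ifP.
  - by rewrite big_ord_recl big_ord1 /= subrK.
  - rewrite big_ord_recl big_ord1 /= scalerDr scalerA mulVf ?gt_eqF // scale1r.
    by rewrite scalerBl scale1r addrA subrK subrKC.
split; first by exists 0, U; split=> // x; rewrite subr0.
by split=> //; apply: filterS nF => x xF /affE.
Qed.

Lemma near_coord p (eps : R) : 0 < eps ->
  nbhs p [set x : 'rV[R]_d | forall i, `|x 0 i - p 0 i| < eps].
Proof.
move=> e0.
apply: (@filter_forall _ _ (fun i (x : 'rV[R]_d) => `|x 0 i - p 0 i| < eps)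
  (nbhs p) _) => i.
have := (@coord_continuous R 1 d 0 i p) => /cvgr_dist_lt /(_ eps e0).
by apply: filterS => x; rewrite distrC.
Qed.

End Dotv.

(** * The descent cone: projection and faces *)

Section Cone.
Context {R : realType} {d : nat} (w : 'rV[R]_d) (I : {set 'I_d}).
Hypothesis w_gt0 : forall i, 0 < w 0 i.
Implicit Types (x y p z v : 'rV[R]_d).

Let w_ge0 i : 0 <= w 0 i. Proof. exact/ltW. Qed.

(** The directional derivative of [wnorm1 w] at a nonnegative vector of support
    [I], in the direction [x]. *)
Definition wdir x : R :=
  \sum_i w 0 i * (if i \in I then x 0 i else `|x 0 i|).

Lemma wdirE x : wdir x =
  \sum_(i in I) w 0 i * x 0 i + \sum_(i | i \notin I) w 0 i * `|x 0 i|.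
Proof.
rewrite /wdir (bigID (mem I)) /=; congr (_ + _); apply: eq_bigr => i.
  by move=> ->.
by move=> /negPf ->.
Qed.

Lemma wdirD_le x y : wdir (x + y) <= wdir x + wdir y.
Proof.
rewrite -big_split; apply: ler_sum => i _; rewrite /= -mulrDr ler_pM2l // mxE.
by case: ifP => // _; exact: ler_normD.
Qed.

Lemma wdirZ c x : 0 <= c -> wdir (c *: x) = c * wdir x.
Proof.
move=> c0; rewrite mulr_sumr; apply: eq_bigr => i _.
by rewrite mxE mulrCA; case: ifP; rewrite ?normrM ?(ger0_norm c0).
Qed.

(** The source of the small steps: how far one can move without changing the
    sign of finitely many coordinates. *)
Lemma pos_lower_bound (P : pred 'I_d) (f : 'I_d -> R) :
  (forall i, P i -> 0 < f i) ->
  exists2 e, 0 < e & forall i, P i -> e <= f i.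
Proof.
move=> f0; exists (\big[Num.min/1]_(i | P i) f i).
  by elim/big_ind: _ => // a b a0 b0; rewrite lt_min a0.
by move=> i Pi; exact: bigmin_le_cond.
Qed.

Section DescentCone.
Variable y : 'rV[R]_d.
Hypotheses (y_ge0 : forall i, 0 <= y 0 i)
  (y_supp : forall i, (y 0 i != 0) = (i \in I)).

(** Convexity: the norm grows at least as fast as its directional derivative.
    This puts the generators of the descent cone in the set where [wdir] is
    nonpositive. *)
Lemma wnorm1_ge_wdir x : wnorm1 w y + wdir x <= wnorm1 w (y + x).
Proof.
rewrite -big_split; apply: ler_sum => i _; rewrite /= -mulrDr ler_pM2l // mxE.
rewrite (ger0_norm (y_ge0 i)); case: ifPn => [_|]; first exact: ler_norm.
by rewrite -y_supp negbK => /eqP ->; rewrite !add0r.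
Qed.

(** For small steps the first-order expansion is exact, because the coordinates
    in the support of [y] keep their sign. *)
Lemma wnorm1_eq_wdir x : (forall i, i \in I -> 0 <= y 0 i + x 0 i) ->
  wnorm1 w (y + x) = wnorm1 w y + wdir x.
Proof.
move=> yx; rewrite -big_split; apply: eq_bigr => i _; rewrite /= -mulrDr mxE.
rewrite (ger0_norm (y_ge0 i)); case: ifPn => [/yx/ger0_norm -> //|].
by rewrite -y_supp negbK => /eqP ->; rewrite !add0r.
Qed.

(** Exactness for small steps makes directions with [wdir x = 0] descent
    directions as well, so that the cone is closed. *)
Lemma descent_coneE : descent_cone (wnorm1 w) y = [set x | wdir x <= 0].
Proof.
apply/seteqP; split=> x /=.
  move=> [n [c [s [cs ->]]]]; elim/big_ind: _ => [|u v u0 v0|i _].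
  - by rewrite -(scale0r (0 : 'rV[R]_d)) wdirZ // mul0r.
  - by rewrite (le_trans (wdirD_le _ _)) // -[leRHS]addr0 lerD.
  have [ci [u uy <-]] := cs i; rewrite wdirZ // mulr_ge0_le0 //.
  have := wnorm1_ge_wdir (u - y); rewrite subrKC; move: uy => /=; lra.
move=> x0.
have [e e0 He] : exists2 e, 0 < e &
    forall i, i \in I -> e <= y 0 i / (1 + `|x 0 i|).
  apply: pos_lower_bound => i; rewrite -y_supp => yi.
  by rewrite divr_gt0 // ?ltr_pwDl // lt_def yi y_ge0.
exists 1%N, (fun=> e^-1), (fun=> e *: x); split; last first.
  by rewrite big_ord1 scalerA mulVf ?gt_eqF // scale1r.
move=> _; split; first by rewrite invr_ge0 ltW.
exists (y + e *: x); last by rewrite addrC addKr.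
rewrite /= wnorm1_eq_wdir ?wdirZ ?(ltW e0) //.
  by rewrite gerDl mulr_ge0_le0 // ltW.
move=> i /He; rewrite ler_pdivlMr ?ltr_pwDl // mxE => yi.
have : e * - `|x 0 i| <= e * x 0 i.
  by rewrite ler_pM2l // lerNl ler_normr lexx orbT.
by move: yi e0; rewrite mulrDr mulr1 mulrN; lra.
Qed.

End DescentCone.

Let C := [set x : 'rV[R]_d | wdir x <= 0].

(** The Karush-Kuhn-Tucker conditions with multiplier [t]: subtracting [t w] on
    [I] and soft-thresholding at level [t w] outside makes [z - p] equal to [t]
    times a subgradient of [wdir] at [p]. *)
Lemma proj_soft_threshold z p (t : R) : 0 <= t -> wdir p = 0 ->
    (forall i, i \in I -> p 0 i = z 0 i - w 0 i * t) ->
    (forall i, i \notin I -> p 0 i =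
       if w 0 i * t < `|z 0 i| then Num.sg (z 0 i) * (`|z 0 i| - w 0 i * t)
       else 0) ->
  is_proj C z p /\ proj C z = p.
Proof.
move=> t0 p0 pI pJ; apply: proj_obtuse => [|c Cc]; first by rewrite /C /= p0.
apply: (@le_trans _ _ (t * wdir c - t * wdir p)); last first.
  by rewrite p0 mulr0 subr0 mulr_ge0_le0.
rewrite !mulr_sumr -sumrB; apply: ler_sum => i _; rewrite !mxE.
have [iI|iI] := boolP (i \in I).
  by rewrite pI // subKr le_eqVlt; apply/orP; left; apply/eqP; ring.
rewrite !mulrA (mulrC t) pJ //; have wt0 : 0 <= w 0 i * t by rewrite mulr_ge0.
have [zt|zt] := ltP; last first.
  (* Below the threshold the component of [z - p] is that of [z], which the
     threshold bounds. *)
  rewrite !subr0 normr0 mulr0 subr0.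
  by rewrite (le_trans (ler_norm _)) // normrM ler_wpM2r.
have z0 : z 0 i != 0 by apply: contraTN zt => /eqP ->; rewrite normr0 -leNgt.
have nz : `|z 0 i| - w 0 i * t > 0 by rewrite subr_gt0.
have ss : Num.sg (z 0 i) * Num.sg (z 0 i) = 1.
  by rewrite -expr2 sqr_sg z0.
have -> : z 0 i - Num.sg (z 0 i) * (`|z 0 i| - w 0 i * t)
        = Num.sg (z 0 i) * (w 0 i * t).
  by rewrite {1}[z 0 i]numEsg; ring.
rewrite normrM normr_sg z0 mul1r (gtr0_norm nz).
rewrite mulrBr; apply: lerB.
  rewrite (le_trans (ler_norm _)) // !normrM normr_sg z0 mul1r.
  by rewrite (ger0_norm (w_ge0 _)) (ger0_norm t0).
by rewrite mulrACA ss mul1r.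
Qed.

(** The functional exposing the face through [p] carries the signs of [p]
    outside [I], hence is at most [wdir]. Equality forces the coordinates outside
    [I] to have weakly the signs of [p], a sign 0 forcing 0; near [p] the nonzero
    signs are automatic, so only linear equations remain. *)
Lemma boundary_face p : (0 < #|I|)%N -> wdir p = 0 ->
  exists F, [/\ is_face C F,
    has_dim F (#|[set i | (i \notin I) && (p 0 i != 0%R)]%SET| + #|I| - 1)
    & relint F p].
Proof.
move=> /card_gt0P [i0 i0I] p0; set A := finset _.
(* Off the support of [p] the sign is 0, so [v] vanishes outside [B] below. *)
pose v : 'rV[R]_d :=
  \row_i (w 0 i * (if i \in I then 1 else Num.sg (p 0 i))).
have vx x : dotv v x =
    \sum_i w 0 i * (if i \in I then x 0 i else Num.sg (p 0 i) * x 0 i).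
  by apply: eq_bigr => i _; rewrite mxE -mulrA; case: ifP; rewrite ?mul1r.
have term x i : w 0 i * (if i \in I then x 0 i else Num.sg (p 0 i) * x 0 i) <=
    w 0 i * (if i \in I then x 0 i else `|x 0 i|).
  rewrite ler_pM2l //; case: ifP => // _.
  rewrite (le_trans (ler_norm _)) // normrM normr_sg.
  by case: (p 0 i != 0); rewrite ?mul1r ?mul0r.
have v_le x : dotv v x <= wdir x by rewrite vx; apply: ler_sum.
have v_eq x : wdir x <= 0 -> dotv v x = 0 ->
    forall i, i \notin I -> Num.sg (p 0 i) * x 0 i = `|x 0 i|.
  move=> x0 xv; have : dotv v x == wdir x by rewrite eq_le v_le /= xv.
  rewrite vx eq_sym -subr_eq0 -sumrB psumr_eq0 => [/allP H i iI|i _].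
    have := H i (mem_index_enum i); rewrite (negPf iI) /= subr_eq0.
    have w0 : w 0 i != 0 by rewrite gt_eqF.
    by rewrite (inj_eq (mulfI w0)) => /eqP.
  by rewrite subr_ge0.
have v_neq0 : v != 0.
  apply/eqP => /(congr1 (fun x : 'rV[R]_d => x 0 i0)) /eqP.
  by rewrite !mxE i0I mulr1 gt_eqF.
pose B := I :|: A.
have v_supp i : i \notin B -> v 0 i = 0.
  rewrite !inE negb_or => /andP [/negPf iI]; rewrite iI negbK => /eqP pi.
  by rewrite mxE iI pi sgr0 mulr0.
have dimB : #|B|.-1 = (#|A| + #|I| - 1)%N.
  rewrite cardsU (_ : I :&: A = finset.set0) ?cards0 ?subn0 ?subn1 1?addnC //.
  by apply/finset.setP => i; rewrite !inE; case: (i \in I).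
have := dim_span_delta_ker v_neq0 v_supp; rewrite dimB.
set U := (_ :&: _)%VS => dimU.
have UP x : x \in U <-> (forall i, i \notin B -> x 0 i = 0) /\ dotv v x = 0.
  rewrite memv_cap mem_ker_dotv.
  by split=> [/andP [/mem_span_delta ? /eqP]|[/mem_span_delta -> ->]];
    rewrite ?eqxx.
exists (C `&` [set x | dotv v x = 0]).
suff [hd hr] : has_dim (C `&` [set x | dotv v x = 0]) (\dim U) /\
    relint (C `&` [set x | dotv v x = 0]) p.
  split; [right; exists v; split=> // x Cx|by rewrite -dimU|by []].
  exact: le_trans (v_le x) Cx.
have p_v : dotv v p = 0.
  rewrite vx -[RHS]p0; apply: eq_bigr => i _; case: ifP => // _.
  by rewrite -normrEsg.
have FP x : x \in U -> (forall i, i \in A -> 0 <= Num.sg (p 0 i) * x 0 i) ->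
    (C `&` [set x | dotv v x = 0]) x.
  move=> /UP [xB xv] xA; split=> //=; rewrite /C /= -[leRHS]xv vx.
  apply: ler_sum => i _; rewrite ler_pM2l //; case: ifPn => // iI.
  have [iA|iA] := boolP (i \in A).
    have := xA i iA; rewrite -{2}(ger0_norm (xA i iA)) normrM normr_sg.
    by move: iA; rewrite !inE iI /= => ->; rewrite mul1r.
  by rewrite xB ?mulr0 ?normr0 // inE (negPf iI) (negPf iA).
apply: has_dim_relint => [x [Cx xv]||].
- apply/UP; split=> // i; rewrite !inE negb_or => /andP [iI].
  rewrite iI negbK => /eqP pi; apply/normr0_eq0.
  by rewrite -(v_eq x) // pi sgr0 mul0r.
- by split=> //; rewrite /C /= p0.
have [e e0 He] : exists2 e, 0 < e & forall i, i \in A -> e <= `|p 0 i|.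
  by apply: pos_lower_bound => i; rewrite !inE normr_gt0 => /andP [].
apply: filterS (near_coord p e0) => x xp xU; apply: FP => // i iA.
have := He i iA; have := xp i; move: iA; rewrite !inE => /andP [iI pi] {}xp ep.
have -> : Num.sg (p 0 i) * x 0 i =
    `|p 0 i| - Num.sg (p 0 i) * (p 0 i - x 0 i).
  by rewrite mulrBr -normrEsg subKr.
rewrite subr_ge0 (le_trans (ler_norm _)) // normrM normr_sg pi mul1r distrC.
by rewrite (le_trans (ltW xp)).
Qed.

(** [wdir] is subadditive and at most [sum_i w_i * eps] on vectors with entries
    bounded by [eps], so it stays negative on a small box around [p]. *)
Lemma interior_relint p : wdir p < 0 -> has_dim C d /\ relint C p.
Proof.
move=> p0; rewrite -[X in has_dim _ X]mul1n -[(1 * d)%N]/(dim 'rV[R]_d) -dimvf.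
apply: has_dim_relint => [x _||]; [exact: memvf|exact: ltW|].
have W0 : 0 < 1 + \sum_i w 0 i by rewrite ltr_pwDl ?sumr_ge0.
have e0 : 0 < - wdir p / (1 + \sum_i w 0 i) by rewrite divr_gt0 // oppr_gt0.
apply: filterS (near_coord p e0) => x xp _; rewrite /C /=.
rewrite -[x](subrKC p) (le_trans (wdirD_le _ _)) // -lerBrDl sub0r.
apply: le_trans (_ : \sum_i w 0 i * (- wdir p / (1 + \sum_i w 0 i)) <= _).
  apply: ler_sum => i _; rewrite ler_pM2l //.
  apply: le_trans (ltW (xp i)); rewrite !mxE.
  by case: ifP => // _; exact: ler_norm.
rewrite -mulr_suml mulrA ler_pdivrMr // mulrC ler_pM2l ?oppr_gt0 //.
by rewrite lerDr.
Qed.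

End Cone.

(** * Coordinates in the orthonormal frame *)

Section Frame.
Context {R : realType} {d : nat} (w : 'rV[R]_d) (I : {set 'I_d}).
Context (q : (#|I|.-1).-tuple 'rV[R]_d) (g : 'I_(#|I|.-1) -> R).
Hypotheses (w_gt0 : forall i, 0 < w 0 i) (I_gt0 : (0 < #|I|)%N).
Hypothesis q_onb : orthonormal_basis q
  [set x : 'rV[R]_d | \sum_(i < d) w 0 i * x 0 i = 0 /\
                        forall i, i \notin I -> x 0 i = 0].

Let a := Num.sqrt (\sum_(i in I) w 0 i ^+ 2).
Let e0' : 'rV[R]_d := - a^-1 *: \sum_(i in I) w 0 i *: delta_mx 0 i.
Let gq : 'rV[R]_d := \sum_i g i *: tnth q i.

Lemma axis_normE : a ^+ 2 = \sum_(i in I) w 0 i ^+ 2.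
Proof. by rewrite sqr_sqrtr // sumr_ge0 // => i _; rewrite sqr_ge0. Qed.

Lemma axis_norm_gt0 : 0 < a.
Proof.
have /card_gt0P [i iI] := I_gt0.
rewrite sqrtr_gt0 (bigD1 i) //= ltr_wpDr ?exprn_gt0 //.
by apply: sumr_ge0 => l _; rewrite sqr_ge0.
Qed.

Lemma axis_in i : i \in I -> e0' 0 i = - (w 0 i / a).
Proof.
by move=> iI; rewrite mxE sum_deltaE iI mulNr mulrC.
Qed.

Lemma axis_out i : i \notin I -> e0' 0 i = 0.
Proof.
by move=> /negPf iI; rewrite mxE sum_deltaE iI mulr0.
Qed.

(** On the vectors vanishing outside [I] the sum over all indices in the
    definition of the tangent space reduces to the sum over [I]. *)
Lemma tangent_q x : x \in <<q>>%VS ->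
  \sum_(i in I) w 0 i * x 0 i = 0 /\ forall i, i \notin I -> x 0 i = 0.
Proof.
move=> /q_onb.2 [xw xI]; split=> //; rewrite -[RHS]xw [RHS](bigID (mem I)) /=.
by rewrite [X in _ + X]big1 ?addr0 // => i iI; rewrite xI // mulr0.
Qed.

Lemma tangent_gq :
  \sum_(i in I) w 0 i * gq 0 i = 0 /\ forall i, i \notin I -> gq 0 i = 0.
Proof.
by apply/tangent_q/memv_suml => i _; apply/memvZ/memv_span/mem_tnth.
Qed.

Lemma dotv_gq : dotv gq gq = \sum_i g i ^+ 2.
Proof.
rewrite dotv_sumr; apply: eq_bigr => i _; rewrite dotvZr dotvC dotv_sumr.
rewrite (bigD1 i) //= big1 => [|l /negPf li].
  rewrite dotvZr !(tnth_nth 0) q_onb.1 ?size_tuple // eqxx mulr1 addr0.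
  by rewrite expr2.
rewrite dotvZr !(tnth_nth 0) q_onb.1 ?size_tuple //.
by rewrite (inj_eq val_inj) eq_sym li mulr0.
Qed.

Lemma frame_orthonormal_basis :
  orthonormal_basis
    (q ++ e0' :: [seq delta_mx 0 i : 'rV[R]_d | i <- enum 'I_d & i \notin I])
    setT.
Proof.
have a0 := axis_norm_gt0.
have e00 : dotv e0' e0' = 1.
  rewrite /dotv (bigID (mem I)) /= [X in _ + X]big1 ?addr0 => [|i iI].
    rewrite (eq_bigr (fun i => w 0 i ^+ 2 / a ^+ 2)) => [|i iI].
      by rewrite -mulr_suml -axis_normE divff // gt_eqF // exprn_gt0.
    by rewrite axis_in // mulrNN mulf_div -!expr2.
  by rewrite axis_out // mul0r.
split.
  apply: orthonormal_cat; first exact: q_onb.1.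
    apply: (orthonormal_cat (s1 := [:: e0'])) => [[|//] [|//] _ _||x x' ].
    - by rewrite /= e00.
    - exact/orthonormal_delta/filter_uniq/enum_uniq.
    rewrite inE => /eqP -> /mapP [i]; rewrite mem_filter => /andP [iI _] ->.
    by rewrite dotv_delta axis_out.
  move=> x x' /memv_span /tangent_q [xw xI]; rewrite inE => /orP [/eqP ->|].
    rewrite dotvZr dotv_sumr (eq_bigr (fun i => w 0 i * x 0 i)) ?xw ?mulr0 //.
    by move=> i _; rewrite dotvZr dotv_delta.
  move=> /mapP [i]; rewrite mem_filter => /andP [iI _] ->.
  by rewrite dotv_delta xI.
move=> x; split=> // _.
set X := <<_>>%VS.
have e0X : e0' \in X by rewrite memv_span // mem_cat mem_head orbT.
have eX i : i \notin I -> delta_mx 0 i \in X.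
  move=> iI; rewrite memv_span // mem_cat inE map_f ?orbT //.
  by rewrite mem_filter iI mem_enum.
have qX v : v \in <<q>>%VS -> v \in X.
  move: v; apply/subvP/span_subvP => v vq.
  by rewrite memv_span // mem_cat vq.
(* Removing the components along the axis and outside [I] leaves a vector of
   the tangent space spanned by [q]. *)
pose x0 := - (\sum_(i in I) w 0 i * x 0 i) / a.
pose xJ := \sum_(i | i \notin I) x 0 i *: delta_mx 0 i : 'rV[R]_d.
have xJE i : xJ 0 i = if i \notin I then x 0 i else 0 by rewrite sum_deltaE.
have yE i : (x - (x0 *: e0' + xJ)) 0 i = x 0 i - (x0 * e0' 0 i + xJ 0 i).
  by rewrite !mxE.
rewrite -[x](subrK (x0 *: e0' + xJ)); apply: memvD; last first.
  by apply: memvD; [exact: memvZ|apply: memv_suml => i iI; apply/memvZ/eX].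
apply/qX/q_onb.2; split=> [|i iI]; last first.
  by rewrite yE axis_out // xJE iI mulr0 add0r subrr.
rewrite (bigID (mem I)) /= [X in _ + X]big1 ?addr0 => [|i iI]; last first.
  by rewrite yE axis_out // xJE iI mulr0 add0r subrr mulr0.
rewrite (eq_bigr (fun i => w 0 i * x 0 i + x0 / a * w 0 i ^+ 2)) => [|i iI].
  rewrite big_split -mulr_sumr -axis_normE /= /x0.
  by field; rewrite gt_eqF.
by rewrite yE axis_in // xJE iI /=; ring.
Qed.

(** The vector with coordinate [x0] along the axis and [c] outside [I]; the
    tangent component is kept fixed, as the projection does not move it. *)
Definition frame (x0 : R) (c : 'I_d -> R) : 'rV[R]_d :=
  x0 *: e0' + \sum_(i | i \notin I) c i *: delta_mx 0 i + gq.

Lemma frame_in x0 c i : i \in I ->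
  frame x0 c 0 i = - (x0 / a) * w 0 i + gq 0 i.
Proof.
move=> iI; rewrite mxE [in LHS]mxE sum_deltaE iI addr0 mxE axis_in //.
by congr (_ + _); ring.
Qed.

Lemma frame_out x0 c i : i \notin I -> frame x0 c 0 i = c i.
Proof.
move=> iI; rewrite mxE [in LHS]mxE sum_deltaE iI mxE axis_out // tangent_gq.2 //.
by rewrite mulr0 add0r addr0.
Qed.

(** The axis is the normalised opposite of [w] on [I], to which the tangent
    component is orthogonal; hence the linear part of [wdir] only sees [x0]. *)
Lemma wdir_frame x0 c : wdir w I (frame x0 c) =
  - (a * x0) + \sum_(i | i \notin I) w 0 i * `|c i|.
Proof.
rewrite wdirE; congr (_ + _); last first.
  by apply: eq_bigr => i iI; rewrite frame_out.
rewrite (eq_bigr (fun i => - (x0 / a) * w 0 i ^+ 2 + w 0 i * gq 0 i)).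
  rewrite big_split -mulr_sumr -axis_normE /= tangent_gq.1 addr0.
  by field; rewrite gt_eqF // axis_norm_gt0.
by move=> i iI; rewrite frame_in //; ring.
Qed.

Lemma enorm_frame x0 c : enorm (frame x0 c) ^+ 2 =
  x0 ^+ 2 + \sum_(i | i \notin I) c i ^+ 2 + \sum_i g i ^+ 2.
Proof.
have gE : dotv gq gq = \sum_(i in I) gq 0 i * gq 0 i.
  rewrite /dotv (bigID (mem I)) /= [X in _ + X]big1 ?addr0 // => i iI.
  by rewrite tangent_gq.2 // mul0r.
rewrite enormE -dotv_gq gE /dotv (bigID (mem I)) /= addrAC.
congr (_ + _); last by apply: eq_bigr => i iI; rewrite frame_out.
rewrite (eq_bigr (fun i => (x0 / a) ^+ 2 * w 0 i ^+ 2 +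
  (gq 0 i * gq 0 i - 2 * (x0 / a) * (w 0 i * gq 0 i)))).
  rewrite 2!big_split /= sumrN -!mulr_sumr -axis_normE tangent_gq.1.
  rewrite mulr0 subr0; congr (_ + _).
  by field; rewrite gt_eqF // axis_norm_gt0.
by move=> i iI; rewrite frame_in //; ring.
Qed.

End Frame.

(** * The rank selected by the thresholds *)

Section Ranking.
Context {R : realType} {d : nat} (w : 'rV[R]_d) (I : {set 'I_d}).
Context (zJ : 'I_d -> R) (j : nat -> 'I_d) (a2 x : R).
Hypotheses (w_gt0 : forall i, 0 < w 0 i) (a2_gt0 : 0 < a2).
Let N := (d - #|I|)%N.
Hypothesis j_perm :
  perm_eq [seq j i | i <- iota 1 N] [seq i <- enum 'I_d | i \notin I].
Hypothesis j_sorted : forall i i',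
  (1 <= i)%N -> (i <= i')%N -> (i' <= N)%N ->
  `|zJ (j i')| / w 0 (j i') <= `|zJ (j i)| / w 0 (j i).

Let S l := \sum_(1 <= i < l.+1) w 0 (j i) * `|zJ (j i)|.
Let A l := a2 + \sum_(1 <= i < l.+1) w 0 (j i) ^+ 2.
Let r i := `|zJ (j i)| / w 0 (j i).

(** Turns the sums over the first [m] ranks of the statement into sums over the
    indices selected by a threshold condition. *)
Lemma big_rank (V : Type) (idx : V) (op : Monoid.com_law idx) (f : 'I_d -> V)
    (P : pred 'I_d) m : (m <= N)%N ->
    (forall i, (1 <= i <= N)%N -> P (j i) = (i <= m)%N) ->
  \big[op/idx]_(1 <= i < m.+1) f (j i) =
  \big[op/idx]_(i | (i \notin I) && P i) f i.
Proof.
move=> mN Pm; transitivity (\big[op/idx]_(i <- [seq j i | i <- iota 1 N])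
    (if P i then f i else idx)); last first.
  by rewrite (perm_big _ j_perm) big_filter big_enum_cond /= big_mkcondr.
rewrite big_map (big_nat_widen _ _ N.+1) // big_mkcond /index_iota subn1.
by apply: eq_big_seq => i; rewrite mem_iota add1n ltnS => /Pm ->.
Qed.

Let b l : \bar R :=
  if (l < N)%N then (S l - A l / w 0 (j l.+1) * `|zJ (j l.+1)|)%:E
  else if l == N then (S N)%:E else +oo%E.

Let A_gt0 l : 0 < A l.
Proof. by rewrite ltr_wpDr // sumr_ge0 // => i _; rewrite sqr_ge0. Qed.

Let SS l : S l.+1 = S l + w 0 (j l.+1) ^+ 2 * r l.+1.
Proof.
rewrite /S big_nat_recr //=; congr (_ + _).
by rewrite /r; field; rewrite gt_eqF.
Qed.

Let AS l : A l.+1 = A l + w 0 (j l.+1) ^+ 2.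
Proof. by rewrite /A big_nat_recr //= addrA. Qed.

Let bE l : (l < N)%N -> b l = (S l - A l * r l.+1)%:E.
Proof. by rewrite /b => ->; rewrite /r mulrA mulrAC. Qed.

(** Passing to the next index adds the same term, [w ^+ 2 * r l.+1], to [S] and
    to [A * r l.+1]; both thresholds are thus of the form [S l.+1 - A l.+1 * s],
    with [s] the old or the new ratio (0 at the end), and the ratios decrease. *)
Lemma threshold_homo : {homo b : l l' / (l <= l')%N >-> (l <= l')%E}.
Proof.
apply: homo_leq => [//|y u v|l]; first exact: le_trans.
have [lN|Nl] := ltnP l N; last first.
  by rewrite [leRHS]/b ltnNge leqW //= gtn_eqF // leey.
have -> : b l = (S l.+1 - A l.+1 * r l.+1)%:E.
  by rewrite bE // SS AS; congr (_%:E); ring.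
have [lN'|Nl'] := ltnP l.+1 N.
  by rewrite bE // lee_fin lerB // ler_pM2l // j_sorted.
have lNE : l.+1 = N by apply/eqP; rewrite eqn_leq lN.
rewrite /b lNE ltnn eqxx lee_fin gerBl mulr_ge0 ?(ltW (A_gt0 _)) //.
by rewrite divr_ge0 // ltW.
Qed.

Let is_m m := ((if m is m'.+1 then b m' else -oo) < x%:E)%E && (x%:E <= b m)%E.

(** The thresholds end with [+oo] and are nondecreasing, so the intervals between
    consecutive ones partition the line; [m] is the first whose upper end is at
    least [x]. *)
Lemma exists_unique_rank : exists! m, is_m m.
Proof.
have ex : exists m, (x%:E <= b m)%E.
  by exists N.+1; rewrite /b ltnNge leqnSn /= gtn_eqF // leey.
case: (ex_minnP ex) => m xm m_min; exists m; split.
  rewrite /is_m xm andbT; case: m {xm} m_min => [|m] m_min; first exact: ltNyr.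
  by rewrite ltNge; apply/negP => /m_min; rewrite ltnn.
move=> m' /andP [m'_lt xm']; apply/eqP; rewrite eqn_leq m_min //=.
case: m' m'_lt {xm'} => // m' m'_lt; rewrite leqNgt ltnS; apply/negP => mm'.
have := lt_le_trans m'_lt (le_trans xm (threshold_homo mm')).
by rewrite ltxx.
Qed.

Lemma rank_le m : is_m m -> (m <= N.+1)%N.
Proof.
move=> /andP [+ _]; case: m => // m; rewrite ltnS leqNgt; apply: contraL => Nm.
by rewrite /b ltnNge (ltnW Nm) /= gtn_eqF // -leNgt leey.
Qed.

Lemma rank_max : is_m N.+1 -> S N < x.
Proof. by move=> /andP [+ _]; rewrite /b ltnn eqxx lte_fin. Qed.

(** The multiplier [t] separates the ratios at rank [m]: the two inequalities
    defining [m] say exactly [t < r m] and [r m.+1 <= t]. *)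
Lemma rank_active m : is_m m -> (m <= N)%N ->
  let t := (- x + S m) / A m in
  0 <= t /\ forall i, (1 <= i <= N)%N ->
    (w 0 (j i) * t < `|zJ (j i)|) = (i <= m)%N.
Proof.
move=> /andP [lo hi] mN t.
have r_ge0 i : 0 <= r i by rewrite divr_ge0 // ltW.
have hi_t : (m < N)%N -> r m.+1 <= t.
  by move=> mN'; move: hi; rewrite bE // lee_fin /t ler_pdivlMr // mulrC; lra.
have lo_t : (0 < m)%N -> t < r m.
  case: m lo @t {hi hi_t} mN => // m lo t mN _; move: lo.
  by rewrite bE // lte_fin /t ltr_pdivrMr // SS AS; lra.
have rE i : (w 0 (j i) * t < `|zJ (j i)|) = (t < r i).
  by rewrite /r ltr_pdivlMr // mulrC.
split.
  move: mN; rewrite leq_eqVlt => /orP [/eqP mN|/hi_t]; last exact: le_trans.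
  move: hi; rewrite /b mN ltnn eqxx lee_fin /t mN => xS.
  by rewrite divr_ge0 ?(ltW (A_gt0 _)) // addrC subr_ge0.
move=> i /andP [i1 iN]; rewrite rE; have [im|mi] := leqP i m.
  apply: (lt_le_trans (lo_t _)); first exact: leq_trans im.
  exact: j_sorted.
apply/negbTE; rewrite -leNgt; apply: le_trans (hi_t _); last exact: leq_trans iN.
exact: j_sorted.
Qed.

End Ranking.

(** * The projection theorem *)

(* j i is meaningful for 1 <= i <= d - |I|, and zJ i for i \notin I.
   For m = d - |I| + 1 there is no index j_m, so the displayed formulas are
   stated for m <= d - |I|; in the remaining case z lies in the interior of C
   and is its own projection. *)
Theorem theorem3p4 (R : realType) (d : nat) (w : 'rV[R]_d) (I : {set 'I_d})
    (y : 'rV[R]_d) (q : (#|I|.-1).-tuple 'rV[R]_d)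
    (z0 : R) (zJ : 'I_d -> R) (g : 'I_(#|I|.-1) -> R) (j : nat -> 'I_d) :
  (forall i, 0 < w 0 i) ->
  (0 < #|I|)%N ->
  (forall i, 0 <= y 0 i) ->
  (forall i, (y 0 i != 0) = (i \in I)) ->
  orthonormal_basis q
    [set x : 'rV[R]_d | \sum_(i < d) w 0 i * x 0 i = 0 /\
                          forall i, i \notin I -> x 0 i = 0] ->
  perm_eq [seq j i | i <- iota 1 (d - #|I|)] [seq i <- enum 'I_d | i \notin I] ->
  (forall i i', (1 <= i)%N -> (i <= i')%N -> (i' <= d - #|I|)%N ->
     `|zJ (j i')| / w 0 (j i') <= `|zJ (j i)| / w 0 (j i)) ->
  let k := #|I| in
  let C := descent_cone (wnorm1 w) y in
  let e := fun i : 'I_d => delta_mx 0 i : 'rV[R]_d in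
  let a := Num.sqrt (\sum_(i in I) w 0 i ^+ 2) in
  let e0' := - a^-1 *: \sum_(i in I) w 0 i *: e i in
  let z := z0 *: e0' + \sum_(i | i \notin I) zJ i *: e i
           + \sum_(i < k.-1) g i *: tnth q i in
  let b := fun l : int =>
    match l with
    | Posz l =>
        if (l < d - k)%N then
          (\sum_(1 <= i < l.+1) w 0 (j i) * `|zJ (j i)|
           - (a ^+ 2 + \sum_(1 <= i < l.+1) w 0 (j i) ^+ 2) / w 0 (j l.+1)
             * `|zJ (j l.+1)|)%:E
        else if l == (d - k)%N then
          (\sum_(1 <= i < (d - k).+1) w 0 (j i) * `|zJ (j i)|)%:E
        else +oo%E
    | Negz _ => -oo%E
    end in
  let is_m := fun m : nat =>
    (b (m%:Z - 1)%R < (a * z0)%:E)%E && ((a * z0)%:E <= b m%:Z)%E in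
  [/\ orthonormal_basis (q ++ e0' :: [seq e i | i <- enum 'I_d & i \notin I])
        setT,
      is_proj C z (proj C z),
      exists! m : nat, is_m m
    & forall m : nat, is_m m ->
      let t := (- (a * z0) + \sum_(1 <= i < m.+1) w 0 (j i) * `|zJ (j i)|)
               / (a ^+ 2 + \sum_(1 <= i < m.+1) w 0 (j i) ^+ 2) in
      let alpha := fun i : nat =>
        w 0 (j i) * `|zJ (j i)| - w 0 (j i) ^+ 2 * t in
      let u := fun i : nat =>
        a^-1 *: e0' + (Num.sg (zJ (j i)) / w 0 (j i)) *: e (j i) in
      [/\ exists F : set 'rV[R]_d,
            [/\ is_face C F, has_dim F (m + k - 1) & relint F (proj C z)],
          (m <= d - k)%N ->
            proj C z = \sum_(1 <= i < m.+1) alpha i *: u i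
                       + \sum_(i < k.-1) g i *: tnth q i,
          (m <= d - k)%N ->
            enorm (proj C z) ^+ 2 =
              (z0 + a * t) ^+ 2
              + \sum_(1 <= i < m.+1) (`|zJ (j i)| - w 0 (j i) * t) ^+ 2
              + \sum_(i < k.-1) g i ^+ 2
        & m = (d - k).+1 ->
            proj C z = z /\
            enorm (proj C z) ^+ 2 =
              z0 ^+ 2 + \sum_(1 <= i < m) `|zJ (j i)| ^+ 2
              + \sum_(i < k.-1) g i ^+ 2]].
Proof.
move=> w_gt0 I_gt0 y_ge0 y_supp q_onb j_perm j_sorted k C e a e0' z b is_m.
have a_gt0 : 0 < a := axis_norm_gt0 w_gt0 I_gt0.
have a2_gt0 : 0 < a ^+ 2 by rewrite exprn_gt0.
have CE : C = [set x | wdir w I x <= 0] := descent_coneE w_gt0 y_ge0 y_supp.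
have kd : (k <= d)%N by rewrite -[leqRHS]card_ord max_card.
pose gq := \sum_(i < k.-1) g i *: tnth q i.
pose fr := frame w q g.
have zE : z = fr z0 zJ by [].
pose rk m := ((if m is m'.+1 then b (Posz m') else -oo) < (a * z0)%:E)%E
  && ((a * z0)%:E <= b (Posz m))%E.
have is_mE m : is_m m = rk m.
  by rewrite /is_m /rk; case: m => // m; rewrite -addn1 PoszD addrK.
have ex : exists! m, rk m.
  exact: (exists_unique_rank (a * z0) w_gt0 a2_gt0 j_sorted).
(* Existence of a nearest point, which does not mention [m], and its description
   in terms of [m] come from one and the same witness [p]. *)
have main m : rk m -> exists2 p, is_proj C z p /\ proj C z = p &
  [/\ exists F : set 'rV[R]_d,
        [/\ is_face C F, has_dim F (m + k - 1) & relint F p],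
      (m = (d - k).+1 -> p = z) &
      (m <= d - k)%N ->
        let t := (- (a * z0) + \sum_(1 <= i < m.+1) w 0 (j i) * `|zJ (j i)|)
               / (a ^+ 2 + \sum_(1 <= i < m.+1) w 0 (j i) ^+ 2) in
        [/\ p = fr (z0 + a * t) (fun i => if w 0 i * t < `|zJ i|
              then Num.sg (zJ i) * (`|zJ i| - w 0 i * t) else 0),
            0 <= t,
            forall i, (1 <= i <= d - k)%N ->
              (w 0 (j i) * t < `|zJ (j i)|) = (i <= m)%N &
            \sum_(1 <= i < m.+1) (w 0 (j i) * `|zJ (j i)| - w 0 (j i) ^+ 2 * t)
              = a * (z0 + a * t)]].
  move=> mP.
  have := rank_le mP; rewrite leq_eqVlt => /orP [/eqP mN|].
    have zC : wdir w I z < 0.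
      rewrite zE wdir_frame // addrC subr_lt0.
      have : \sum_(1 <= i < (d - k).+1) w 0 (j i) * `|zJ (j i)| < a * z0.
        by move: mP; rewrite mN; exact: rank_max.
      apply: le_lt_trans.
      rewrite (big_rank j_perm _ (fun i => w 0 i * `|zJ i|) (P := predT)
        (leqnn _)).
        by rewrite (eq_bigl (fun i => i \notin I)) // => i; rewrite andbT.
      by move=> i /andP [_ ->].
    have [hd hr] := interior_relint w_gt0 zC.
    exists z; first apply: proj_obtuse.
    - by rewrite CE; exact: ltW.
    - by move=> c _; rewrite subrr dotvC dotv0r.
    split=> //; last by rewrite mN ltnn.
    exists C; split; first by left.
      rewrite CE (_ : (m + k - 1)%N = d) // mN.
      by rewrite addSn subn1 /= subnK.
    by rewrite CE.
  rewrite ltnS => mN.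
  have [t0 tA] := rank_active w_gt0 a2_gt0 j_sorted mP mN.
  set t := (_ / _) in t0 tA *.
  have A_neq0 : a ^+ 2 + \sum_(1 <= i < m.+1) w 0 (j i) ^+ 2 != 0.
    by rewrite gt_eqF // ltr_wpDr // sumr_ge0 // => i _; rewrite sqr_ge0.
  (* This is where the formula for [t] comes from: it makes [p] a boundary
     point. *)
  have alpha : \sum_(1 <= i < m.+1)
      (w 0 (j i) * `|zJ (j i)| - w 0 (j i) ^+ 2 * t) = a * (z0 + a * t).
    by rewrite sumrB -mulr_suml /t; field.
  pose act i := w 0 i * t < `|zJ i|.
  pose c i := if w 0 i * t < `|zJ i|
              then Num.sg (zJ i) * (`|zJ i| - w 0 i * t) else 0.
  have c_norm i : `|c i| =
      if w 0 i * t < `|zJ i| then `|zJ i| - w 0 i * t else 0.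
    rewrite /c; case: ltP => [lt|_]; last exact: normr0.
    have z_neq0 : zJ i != 0.
      by apply: contraTN lt => /eqP ->; rewrite normr0 -leNgt mulr_ge0 // ltW.
    by rewrite normrM normr_sg z_neq0 mul1r gtr0_norm // subr_gt0.
  pose p := fr (z0 + a * t) c.
  have p0 : wdir w I p = 0.
    rewrite wdir_frame // -alpha addrC; apply/eqP; rewrite subr_eq0; apply/eqP.
    rewrite (big_rank j_perm _ (fun i => w 0 i * `|zJ i| - w 0 i ^+ 2 * t)
      (P := act) mN tA).
    rewrite [RHS]big_mkcondr; apply: eq_bigr => i _; rewrite c_norm /act.
    by case: ifP; rewrite ?mulr0 // => _; ring.
  have [is_p pE] : is_proj C z p /\ proj C z = p.
    rewrite CE; apply: (proj_soft_threshold w_gt0 t0 p0) => i iI.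
      by rewrite zE !frame_in // -/a; field; rewrite gt_eqF.
    by rewrite zE !frame_out.
  exists p => //; split=> [|mE|]; last by [].
    have [F [FC Fd Fr]] := boundary_face w_gt0 I_gt0 p0.
    exists F; split=> //; first by rewrite CE.
    rewrite (_ : m = #|[set i | (i \notin I) && (p 0 i != 0%R)]%SET|) //.
    have := big_rank j_perm addn (fun=> 1%N) (P := act) mN tA.
    rewrite sum_nat_const_nat muln1 subn1 sum1dep_card /= => {1}->.
    apply: eq_card => i; rewrite !inE; case: (boolP (i \in I)) => //= iI.
    rewrite frame_out // -normr_eq0 c_norm /act.
    by case: ltP => [lt|_]; rewrite ?eqxx // gt_eqF // subr_gt0.
  by move: mN; rewrite mE ltnn.
have [m0 [m0P m0_uniq]] := ex.
have [p0 [p0_proj p0E] _] := main m0 m0P.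
split; first exact: frame_orthonormal_basis.
- by rewrite p0E.
- by exists m0; split=> [|m]; rewrite is_mE //; apply: m0_uniq.
move=> m; rewrite is_mE => mP t alpha u.
have [p [_ ->] [hF hz hp]] := main m mP.
split=> // [mN|mN|mE].
- have [-> t0 tA al] := hp mN; rewrite -/t in t0 tA al *.
  pose act i := w 0 i * t < `|zJ i|.
  rewrite /fr /frame -/e0' -/gq; congr (_ + _).
  rewrite (eq_bigr (fun i => (alpha i / a) *: e0' +
    (Num.sg (zJ (j i)) * (`|zJ (j i)| - w 0 (j i) * t)) *: e (j i))); last first.
    move=> i _; rewrite /u scalerDr !scalerA; congr (_ + _ *: _).
    by rewrite /alpha; field; rewrite gt_eqF.
  rewrite big_split -scaler_suml -mulr_suml /= al; congr (_ *: _ + _).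
    by field; rewrite gt_eqF.
  rewrite (big_rank j_perm _ (fun i =>
    (Num.sg (zJ i) * (`|zJ i| - w 0 i * t)) *: e i) (P := act) mN tA).
  rewrite [RHS]big_mkcondr /act; apply: eq_bigr => i _.
  by case: ifP; rewrite ?scale0r.
- have [-> t0 tA al] := hp mN; rewrite -/t in t0 tA al *.
  pose act i := w 0 i * t < `|zJ i|.
  rewrite enorm_frame //; congr (_ + _ + _).
  rewrite (big_rank j_perm _ (fun i => (`|zJ i| - w 0 i * t) ^+ 2) (P := act) mN tA).
  rewrite [RHS]big_mkcondr /act; apply: eq_bigr => i _.
  case: ifP => [lt|_]; last by rewrite expr0n.
  have z_neq0 : zJ i != 0.
    by apply: contraTN lt => /eqP ->; rewrite normr0 -leNgt mulr_ge0 // ltW.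
  by rewrite exprMn sqr_sg z_neq0 mul1r.
- rewrite hz // zE enorm_frame // mE; split=> //; congr (_ + _ + _).
  rewrite (big_rank j_perm _ (fun i => `|zJ i| ^+ 2) (P := predT) (leqnn _)).
    rewrite (eq_bigl (fun i => i \notin I)) => [|i]; last by rewrite andbT.
    by apply: eq_bigr => i _; rewrite real_normK // num_real.
  by move=> i /andP [_ ->].
Qed.
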